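(* Let $P$ and $Q$ be the stationary observable processes generated by exact finite-state generator $\epsilon$-machines $G_P$ and $G_Q$ over the same nonempty finite alphabet $\mathcal X$. Put $$a=L_{\mathrm{tar}}(G_P),\qquad b=L_{\mathrm{tar}}(G_Q),\qquad d=\max\{L_{\mathrm{sep}}(G_P),L_{\mathrm{sep}}(G_Q)\}.$$ Let $L,R\ge1$ be integers and suppose that $C_{L,R}(P)=C_{L,R}(Q)$. Then $G_P\cong G_Q$ provided that at least one of the following two conditions holds: (A) $L\ge a+b+1$ and $R\ge\max\{1,d\}$; (B) $L\ge a+b$ and $R\ge d+1$.
   Context: Words. $\mathcal X$ is a nonempty finite alphabet, $\mathcal X^m$ the words of length $m$, $\mathcal X^*$ all finite words, $\lambda$ the empty word; $X_i^j=(X_i,\dots,X_j)$. Generator. A finite-state generator $\epsilon$-machine over $\mathcal X$ is $G=(\mathcal S,\pi,\delta,\{e_\sigma\}_{\sigma\in\mathcal S})$ where: (1) $\mathcal S$ is a nonempty finite set of states and each $e_\sigma$ is a probability mass function on $\mathcal X$; (2) a pair $(\sigma,x)$ is admissible when $e_\sigma(x)>0$, and a successor $\delta(\sigma,x)\in\mathcal S$ is defined exactly on admissible pairs; (3) the directed graph of positive-probability labeled transitions $\sigma\to\delta(\sigma,x)$ is strongly connected; (4) for $\sigma\neq\tau$ there is a word $w\in\mathcal X^*$ with $p_\sigma(w)\neq p_\tau(w)$, where $p_\sigma(w)=P(X_1^{|w|}=w\mid S_0=\sigma)$ (so $p_\sigma(\lambda)=1$); (5) $\pi$ is the unique probability vector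 with $\pi T=\pi$, where $T_{\sigma\tau}=\sum_{x:\,e_\sigma(x)>0,\ \delta(\sigma,x)=\tau}e_\sigma(x)$. The dynamics are $P(X_{t+1}=x,S_{t+1}=\delta(\sigma,x)\mid S_t=\sigma)=e_\sigma(x)$ for admissible $(\sigma,x)$, and the process generated by $G$ is the observable process $(X_t)_{t\in\mathbb Z}$ of the stationary joint law with $S_0\sim\pi$. The map $\delta$ is extended to words by iteration along admissible paths, $\delta(\sigma,\lambda)=\sigma$. Conditional tables. For a stationary process $P$ and $L\ge1$ let $\mathcal U_L(P)=\{u\in\bigcup_{\ell=1}^L\mathcal X^\ell: P(X_{-|u|+1}^0=u)>0\}$. For $u\in\mathcal U_L(P)$ and a word $v$ with $0\le|v|\le R$ put $P(v\mid u)=P(X_1^{|v|}=v\mid X_{-|u|+1}^0=u)$, $P(\lambda\mid u)=1$. The labeled table is $C_{L,R}(P)=(P(v\mid u))_{u\in\mathcal U_L(P),\,|v|\le R}$. Equality $C_{L,R}(P)=C_{L,R}(Q)$ means $\mathcal U_L(P)=\mathcal U_L(Q)$ and $P(v\mid u)=Q(v\mid u)$ for every indexed pair $(u,v)$. Synchronization. A positive-probability word $w\in\mathcal X^m$, $m\ge0$, synchronizes to $\sigma$ if $P(S_m=\sigma\mid X_1^m=w)=1$ (conditioning on $\lambda$ is trivial). $G$ is exact if it has a finite positive-probability synchronizing word. Radii. $L_{\mathrm{tar}}(G)=\max_{\sigma\in\mathcal S}\inf\{|w|: w\text{ synchronizes to }\sigma\}$ ($\inf\emptyset=\infty$), and $L_{\mathrm{sep}}(G)=\max_{\sigma\neq\tau}\min\{|v|:p_\sigma(v)\neq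 p_\tau(v)\}$. For a one-state generator both radii are set to $0$. Isomorphism. $G\cong G'$ if there is a bijection $f:\mathcal S\to\mathcal S'$ with $\pi'(f(\sigma))=\pi(\sigma)$, $e'_{f(\sigma)}(x)=e_\sigma(x)$ and $\delta'(f(\sigma),x)=f(\delta(\sigma,x))$ for every admissible $(\sigma,x)$. *)

(* Defs.v *)
From HB Require Import structures.
From mathcomp Require Import all_boot all_order all_algebra.
From mathcomp Require Import all_classical all_reals all_analysis.
Set Implicit Arguments.
Unset Strict Implicit.
Unset Printing Implicit Defensive.
Import Order.TTheory GRing.Theory Num.Theory.
Local Open Scope classical_set_scope.
Local Open Scope ring_scope.

Definition pmf (R : realType) (T : finType) (f : T -> R) : Prop :=
  (forall x, 0 <= f x) /\ \sum_x f x = 1.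

(* The raw data (S, pi, delta, e); [delta s x = None] means that no successor
   is defined at (s, x). The axioms are in [generator] below. *)
Record machine (R : realType) (A : finType) := Machine {
  state : finType;
  stat : state -> R;
  delta : state -> A -> option state;
  emit : state -> A -> R
}.

Section Machine.
Variables (R : realType) (A : finType) (G : machine R A).
Implicit Types (s t : state G) (x : A) (w : seq A) (p : seq (state G)).

Definition admissible s x : bool := 0 < emit s x.

Definition edge s t : bool :=
  [exists x, admissible s x && (delta s x == Some t)].

Definition trans s t : R :=
  \sum_(x | admissible s x && (delta s x == Some t)) emit s x.

Definition stationary_pmf (q : state G -> R) : Prop :=
  pmf q /\ forall t, \sum_s q s * trans s t = q t.

(* P(X_{k+1} = x, S_{k+1} = t | S_k = s) *)
Definition step s x t : R :=
  if admissible s x && (delta s x == Some t) then emit s x else 0.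

(* P(X_1^n = w, S_1^n = p | S_0 = s), where n = |w| = |p| *)
Fixpoint path_prob s w p : R :=
  match w, p with
  | [::], [::] => 1
  | x :: w', t :: p' => step s x t * path_prob t w' p'
  | _, _ => 0
  end.

(* p_s(w) = P(X_1^{|w|} = w | S_0 = s) *)
Definition word_prob s w : R :=
  \sum_(p : (size w).-tuple (state G)) path_prob s w p.

(* P(X_1^{|w|} = w), with S_0 distributed as pi *)
Definition obs_prob w : R := \sum_s stat s * word_prob s w.

(* P(X_1^{|w|} = w, S_{|w|} = t), with S_0 distributed as pi *)
Definition obs_end_prob w t : R :=
  \sum_s stat s *
    \sum_(p : (size w).-tuple (state G) | last s p == t) path_prob s w p.

Record generator : Prop := IsGenerator {
  state_nonempty : (0 < #|state G|)%N;
  emit_pmf : forall s, pmf (emit s);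
  delta_defined : forall s x, isSome (delta s x) = admissible s x;
  strongly_connected : forall s t, connect edge s t;
  states_distinct : forall s t, s != t ->
    exists w, word_prob s w <> word_prob t w;
  stat_stationary : stationary_pmf (@stat R A G);
  stat_unique : forall q, stationary_pmf q -> forall s, q s = stat s
}.

Definition synchronizes w s : Prop :=
  0 < obs_prob w /\ obs_end_prob w s / obs_prob w = 1.

Definition exact_machine : Prop := exists w s, synchronizes w s.

(* The radii live in \bar R, so that the infimum of the empty set is +oo; the
   infimum of a nonempty set of lengths is attained, hence a minimum. *)
Definition L_tar : \bar R :=
  if #|state G| == 1%N then 0%E else
  \big[maxe/0%E]_(s : state G)
    ereal_inf [set ((size w)%:R)%:E | w in [set w | synchronizes w s]].

Definition L_sep : \bar R :=
  if #|state G| == 1%N then 0%E else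
  \big[maxe/0%E]_(st : state G * state G | st.1 != st.2)
    ereal_inf [set ((size v)%:R)%:E |
      v in [set v | word_prob st.1 v <> word_prob st.2 v]].

End Machine.

Definition isomorphic (R : realType) (A : finType) (G G' : machine R A) : Prop :=
  exists f : state G -> state G',
    [/\ bijective f,
        forall s, stat (f s) = stat s,
        forall s x, emit (f s) x = emit s x &
        forall s x, admissible s x -> delta (f s) x = omap f (delta s x)].

(* A process (X_t), t in Z, with values in a finite alphabet. *)
Record process (R : realType) (A : finType) := Process {
  disp : measure_display;
  space : measurableType disp;
  law : probability space R;
  obs : int -> space -> A;
  obs_measurable : forall t x, measurable [set o | obs t o = x]
}.

(* block X i n o is the word X_i^{i+n-1}(o). *)
Definition block (B T : Type) (X : int -> T -> B) (i : int) (n : nat) (o : T) :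
  seq B := mkseq (fun k => X (i + k%:Z) o) n.

(* P is the observable component of a joint process (S_t, X_t) whose
   finite-dimensional laws, in every time window, are those of the dynamics of
   G with S_t distributed as pi. *)
Definition generates (R : realType) (A : finType) (G : machine R A)
    (P : process R A) : Prop :=
  exists S : int -> space P -> state G,
    (forall t s, measurable [set o | S t o = s]) /\
    forall (t : int) (n : nat) (s : state G) (w : n.-tuple A)
        (p : n.-tuple (state G)),
      law P [set o | [/\ S t o = s, block (@obs _ _ P) (t + 1) n o = w
                       & block S (t + 1) n o = p]]
      = (stat s * path_prob s w p)%:E.

Section Table.
Variables (R : realType) (A : finType) (P : process R A).

(* X_{-|u|+1}^0 = u *)
Definition past (u : seq A) : set (space P) :=
  [set o | block (@obs _ _ P) (1 - (size u)%:Z) (size u) o = u].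

(* X_1^{|v|} = v *)
Definition future (v : seq A) : set (space P) :=
  [set o | block (@obs _ _ P) 1 (size v) o = v].

Definition contexts (L : nat) : set (seq A) :=
  [set u | (1 <= size u <= L)%N /\ (0 < law P (past u))%E].

Definition cond_prob (v u : seq A) : R :=
  fine (law P (future v `&` past u)) / fine (law P (past u)).

End Table.

(* C_{L,r}(P) = C_{L,r}(Q) *)
Definition same_table (R : realType) (A : finType) (L r : nat)
    (P Q : process R A) : Prop :=
  contexts P L = contexts Q L /\
  forall u v, contexts P L u -> (size v <= r)%N ->
    cond_prob P v u = cond_prob Q v u.

(* Main.v *)
(* A word u that synchronizes G_P to s and G_Q to t makes the conditional future
   given u equal to the future from s, resp. from t; if u is indexed by the
   table, s and t then have the same word probabilities up to length R.
   For each s such a u exists with |u| <= a + b: take w synchronizing G_P to s;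
   since w has positive probability under Q, it can be emitted from some state
   of G_Q, and one puts before w a word synchronizing G_Q to that state. As
   R >= d, agreement up to length R is a bijection between the states.
   It commutes with the transition by x because in case (A) the word u x is
   still indexed by the table, while in case (B) agreement up to length R gives
   agreement up to length R - 1 >= d after x. The stationary laws correspond by
   uniqueness. *)
Require Import Defs.
From HB Require Import structures.
From mathcomp Require Import all_boot all_order all_algebra.
From mathcomp Require Import all_classical all_reals all_analysis.
Set Implicit Arguments.
Unset Strict Implicit.
Unset Printing Implicit Defensive.
Import Order.TTheory GRing.Theory Num.Theory.
Local Open Scope classical_set_scope.
Local Open Scope ring_scope.

(** * Word probabilities split by end state *)

Lemma big_tuple_cons (R : nmodType) (T : finType) (n : nat)
    (C : pred (seq T)) (F : seq T -> R) :
  \sum_(p : n.+1.-tuple T | C p) F p =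
  \sum_t \sum_(p : n.-tuple T | C (t :: p)) F (t :: p).
Proof.
rewrite pair_big_dep /=.
rewrite (reindex (fun q : T * n.-tuple T => [tuple of q.1 :: q.2])) //=.
exists (fun p => (thead p, [tuple of behead p])).
  by move=> [t p] _; rewrite theadE; congr pair; apply: val_inj.
by move=> p _; rewrite [RHS]tuple_eta.
Qed.

Section Words.
Variables (R : realType) (A : finType) (G : machine R A).
Implicit Types (s t : state G) (x : A) (u v w : seq A).

(** The inner sum of [obs_end_prob], isolated because it obeys a Chapman-Kolmogorov rule under
    concatenation; [obs_end_prob] unfolds to it by conversion. *)
Definition end_prob s w t : R :=
  \sum_(p : (size w).-tuple (state G) | last s p == t) path_prob s w p.

Lemma end_prob_nil s t : end_prob s [::] t = (s == t)%:R.
Proof.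
rewrite /end_prob /= (eq_bigl (fun _ => s == t)); last by move=> p; rewrite tuple0.
case: eqP => _; last by rewrite big_pred0.
rewrite (big_pred1 [tuple]) // => p.
by symmetry; apply/eqP; apply: tuple0.
Qed.

Lemma end_prob_cons s x w t :
  end_prob s (x :: w) t = \sum_t' step s x t' * end_prob t' w t.
Proof.
rewrite /end_prob (big_tuple_cons _ (fun p => last s p == t) (path_prob s (x :: w))).
by apply: eq_bigr => t' _; rewrite big_distrr.
Qed.

Lemma word_probE s w : word_prob s w = \sum_t end_prob s w t.
Proof.
by rewrite /word_prob (partition_big (fun p : (size w).-tuple _ => last s p) xpredT).
Qed.

Lemma end_prob_cat s u w t :
  end_prob s (u ++ w) t = \sum_t' end_prob s u t' * end_prob t' w t.
Proof.
elim: u s => [|x u IH] s.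
  rewrite (bigD1 s) //= end_prob_nil eqxx mul1r big1 ?addr0 // => t' ne.
  by rewrite end_prob_nil eq_sym (negbTE ne) mul0r.
rewrite /= end_prob_cons.
under [LHS]eq_bigr => t1 _ do rewrite IH big_distrr.
rewrite exchange_big /=; apply: eq_bigr => t' _.
by rewrite end_prob_cons big_distrl /=; apply: eq_bigr => t2 _; rewrite mulrA.
Qed.

Lemma word_prob_cat s u w :
  word_prob s (u ++ w) = \sum_t end_prob s u t * word_prob t w.
Proof.
rewrite word_probE; under [LHS]eq_bigr => s1 _ do rewrite end_prob_cat.
rewrite exchange_big; apply: eq_bigr => t _.
by rewrite word_probE big_distrr.
Qed.

Lemma word_prob_nil s : word_prob s [::] = 1.
Proof.
rewrite word_probE (bigD1 s) //= end_prob_nil eqxx big1 ?addr0 // => t ne.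
by rewrite end_prob_nil eq_sym (negbTE ne).
Qed.

Lemma obs_end_prob_cat u w t :
  obs_end_prob (u ++ w) t = \sum_t' obs_end_prob u t' * end_prob t' w t.
Proof.
transitivity (\sum_s stat s * end_prob s (u ++ w) t); first by [].
under [LHS]eq_bigr => s1 _ do rewrite end_prob_cat big_distrr.
rewrite exchange_big; apply: eq_bigr => t' _; rewrite big_distrl /=.
by apply: eq_bigr => s _; rewrite mulrA.
Qed.

Lemma obs_prob_cat u w :
  obs_prob G (u ++ w) = \sum_(t : state G) obs_end_prob u t * word_prob t w.
Proof.
rewrite /obs_prob; under [LHS]eq_bigr => s1 _ do rewrite word_prob_cat big_distrr.
rewrite exchange_big; apply: eq_bigr => t' _; rewrite big_distrl /=.
by apply: eq_bigr => s _; rewrite mulrA.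
Qed.

Lemma obs_probE w : obs_prob G w = \sum_(t : state G) obs_end_prob w t.
Proof.
rewrite -[w in LHS]cats0 obs_prob_cat.
by apply: eq_bigr => t _; rewrite word_prob_nil mulr1.
Qed.

Lemma obs_end_prob_nil t : obs_end_prob [::] t = stat t.
Proof.
transitivity (\sum_s stat s * end_prob s [::] t); first by [].
rewrite (bigD1 t) //= end_prob_nil eqxx mulr1 big1 ?addr0 // => s ne.
by rewrite end_prob_nil (negbTE ne) mulr0.
Qed.

Lemma step_ge0 s x t : 0 <= step s x t.
Proof. by rewrite /step; case: ifP => // /andP[/ltW]. Qed.

Lemma end_prob_ge0 s w t : 0 <= end_prob s w t.
Proof.
elim: w s => [|x w IH] s; first by rewrite end_prob_nil ler0n.
by rewrite end_prob_cons sumr_ge0 // => t' _; rewrite mulr_ge0 ?step_ge0.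
Qed.

(* Unifilarity: a start state and a word determine the end state. *)
Lemma end_prob_deterministic s w :
  exists t, forall t', t' != t -> end_prob s w t' = 0.
Proof.
elim: w s => [|x w IH] s.
  by exists s => t' ne; rewrite end_prob_nil eq_sym (negbTE ne).
case E: (delta s x) => [t1|].
  have [t Ht] := IH t1; exists t => t' ne; rewrite end_prob_cons big1 // => t2 _.
  have [->|ne2] := eqVneq t2 t1; first by rewrite Ht ?mulr0.
  rewrite /step E (_ : (Some t1 == Some t2) = false) ?andbF ?mul0r //.
  by apply: contraNF ne2 => /eqP[->].
by exists s => t' _; rewrite end_prob_cons big1 // => t2 _; rewrite /step E andbF mul0r.
Qed.

Lemma word_prob_cons s x w t : delta s x = Some t -> admissible s x ->
  word_prob s (x :: w) = emit s x * word_prob t w.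
Proof.
move=> E ad; rewrite word_probE; under [LHS]eq_bigr => s1 _ do rewrite end_prob_cons.
rewrite exchange_big (bigD1 t) //= [X in _ + X]big1 => [|t2 ne].
  by rewrite addr0 -big_distrr -word_probE /step ad E eqxx.
rewrite big1 // => t3 _; rewrite /step E (_ : (Some t == Some t2) = false) ?andbF ?mul0r //.
by apply: contraNF ne => /eqP[->].
Qed.

(** * Positivity of the stationary law and synchronizing words *)

Section Generator.
Hypothesis hG : generator G.

Lemma emit_ge0 s x : 0 <= emit s x.
Proof. by case: (emit_pmf hG s). Qed.

Lemma word_prob1 s x : word_prob s [:: x] = emit s x.
Proof.
have ad := delta_defined hG s x.
case E: (delta s x) ad => [t|] /= /esym ad.
  by rewrite (word_prob_cons _ E) // word_prob_nil mulr1.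
(* Without a successor the pair is inadmissible, so the nonnegative emission is 0, and so is every
   step. *)
move: ad; rewrite /admissible lt_neqAle emit_ge0 andbT => /negbFE/eqP <-.
rewrite word_probE big1 // => t _; rewrite end_prob_cons big1 // => t' _.
by rewrite /step E andbF mul0r.
Qed.

Lemma stat_ge0 s : 0 <= stat s.
Proof. by case: (stat_stationary hG) => -[]. Qed.

Lemma trans_ge0 s t : 0 <= trans s t.
Proof. by rewrite sumr_ge0 // => x _; apply: emit_ge0. Qed.

Lemma trans_gt0 s t : edge s t -> 0 < trans s t.
Proof.
case/existsP=> x /andP[ad E]; rewrite /trans (bigD1 x) ?ad //=.
by rewrite ltr_wpDr // sumr_ge0 // => y _; apply: emit_ge0.
Qed.

(** Some state carries mass because the total is 1; stationarity passes positive mass along each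
    edge, and strong connectivity reaches [s]. *)
Lemma stat_gt0 s : 0 < stat s.
Proof.
have [[_ sum1] st] := stat_stationary hG.
have [s0 s0P] : exists s0, 0 < stat s0 :> R.
  apply: contrapT => /forallNP no.
  have : (1 : R) <= 0.
    rewrite -sum1 sumr_le0 // => s0 _; rewrite leNgt; apply/negP; exact: no.
  by rewrite ler10.
have /connectP[p] := strongly_connected hG s0 s.
elim: p s0 s0P => [|t p IH] s0 s0P /=; first by move=> _ ->.
case/andP=> e pt; apply: IH pt; apply: (@lt_le_trans _ _ (stat s0 * trans s0 t)).
  by rewrite mulr_gt0 ?trans_gt0.
rewrite -(st t) (bigD1 s0) //= lerDl sumr_ge0 // => s1 _.
by rewrite mulr_ge0 ?stat_ge0 ?trans_ge0.
Qed.

Lemma obs_end_prob_ge0 w t : 0 <= obs_end_prob w t.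
Proof.
by apply: sumr_ge0 => s _; rewrite mulr_ge0 ?stat_ge0 // (end_prob_ge0 s w t).
Qed.

(** Trades the quotient for vanishing terms: the end masses are nonnegative and sum to
    [obs_prob G w], so ratio 1 leaves nothing for the other states. *)
Lemma synchronizesP w s :
  synchronizes w s <->
  0 < obs_prob G w /\ forall t, t != s -> obs_end_prob w t = 0.
Proof.
have split_s : obs_prob G w = obs_end_prob w s + \sum_(t | t != s) obs_end_prob w t.
  by rewrite obs_probE (bigD1 s).
split=> -[pos H]; split=> //.
  have e : obs_end_prob w s = obs_prob G w.
    by rewrite -[LHS](divfK (lt0r_neq0 pos)) H mul1r.
  have /psumr_eq0P : \sum_(t | t != s) obs_end_prob w t = 0.
    by apply: (@addrI _ (obs_end_prob w s)); rewrite -split_s addr0.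
  by apply=> t _; apply: obs_end_prob_ge0.
by move: pos; rewrite split_s (eq_bigr _ H) big1 // addr0 => /lt0r_neq0/divff.
Qed.

Lemma obs_prob_sync_cat w v s : synchronizes w s ->
  obs_prob G (w ++ v) = obs_prob G w * word_prob s v.
Proof.
case/synchronizesP => _ H; rewrite obs_prob_cat obs_probE.
rewrite (bigD1 s) //= big1 ?addr0; last by move=> t ne; rewrite H ?mul0r.
rewrite [in RHS](bigD1 s) //= [X in _ + X]big1 ?addr0 //.
Qed.

(** As [stat] charges every state, no start state at all leads by [w] to a state other than [s];
    hence what is read before [w] does not matter. *)
Lemma sync_cat_left u w s :
  synchronizes w s -> 0 < obs_prob G (u ++ w) -> synchronizes (u ++ w) s.
Proof.
move=> /synchronizesP[_ H] pos; apply/synchronizesP; split=> // t ne.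
rewrite obs_end_prob_cat big1 // => t' _.
suff -> : end_prob t' w t = 0 by rewrite mulr0.
have /psumr_eq0P/(_ t' isT)/eqP : \sum_s' stat s' * end_prob s' w t = 0 := H t ne.
rewrite mulf_eq0 gt_eqF ?stat_gt0 //= => /(_ _)/eqP; apply=> s' _.
by rewrite mulr_ge0 ?stat_ge0 ?end_prob_ge0.
Qed.

(** After [u] the state is [s], and by unifilarity [w] leads from [s] to one state only. *)
Lemma sync_cat_right u w s : synchronizes u s -> 0 < word_prob s w ->
  exists t, synchronizes (u ++ w) t.
Proof.
move=> su pos; have [upos H] := (synchronizesP u s).1 su.
have [t Ht] := end_prob_deterministic s w; exists t; apply/synchronizesP.
split; first by rewrite (obs_prob_sync_cat _ su) mulr_gt0.
move=> t' ne; rewrite obs_end_prob_cat big1 // => s' _.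
by have [->|nes] := eqVneq s' s; [rewrite Ht ?mulr0 | rewrite H ?mul0r].
Qed.

Lemma sync_rcons u s x t : synchronizes u s -> admissible s x ->
  delta s x = Some t -> synchronizes (rcons u x) t.
Proof.
move=> su ad E; have [upos H] := (synchronizesP u s).1 su.
rewrite -cats1; apply/synchronizesP; split.
  by rewrite (obs_prob_sync_cat _ su) word_prob1 mulr_gt0.
move=> t' ne; rewrite obs_end_prob_cat big1 // => s' _.
have [->|nes] := eqVneq s' s; last by rewrite H ?mul0r.
rewrite end_prob_cons big1 ?mulr0 // => t2 _; rewrite end_prob_nil.
have [->|] := eqVneq t2 t'; last by rewrite mulr0.
rewrite /step E (_ : (Some t == Some t') = false) ?andbF ?mul0r //.
by apply: contraNF ne => /eqP[->].
Qed.

Lemma exists_letter s : exists x, 0 < emit s x.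
Proof.
have [_ sum1] := emit_pmf hG s; apply: contrapT => /forallNP no.
have : (1 : R) <= 0; last by rewrite ler10.
by rewrite -sum1 sumr_le0 // => x _; rewrite leNgt; apply/negP; exact: no.
Qed.

Lemma obs_prob_gt0 w : 0 < obs_prob G w -> exists s : state G, 0 < word_prob s w.
Proof.
apply: contraPP => /forallNP no; apply/negP; rewrite -leNgt sumr_le0 // => s _.
by rewrite mulr_ge0_le0 ?stat_ge0 // leNgt; apply/negP; exact: no.
Qed.

(** After the empty word the state still has law [stat], which charges every state. *)
Lemma sync_nil_unique s : synchronizes [::] s -> forall t, t = s.
Proof.
case/synchronizesP => _ H t; apply/eqP; apply: contraT => /H.
by rewrite obs_end_prob_nil => e; have := stat_gt0 t; rewrite e ltxx.
Qed.

End Generator.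
End Words.

(** * Radii as bounds by natural numbers *)

Section Radii.
Variable R : realType.
Local Open Scope ereal_scope.

(** Lengths are integers: if all of them exceed [n], their infimum is at least [n + 1]. *)
Lemma ereal_inf_le_natr (T : Type) (f : T -> nat) (P : set T) (n : nat) :
  ereal_inf [set ((f w)%:R : R)%:E | w in P] <= (n%:R)%:E ->
  exists2 w, P w & (f w <= n)%N.
Proof.
move=> le_n; apply: contrapT => no.
have : (n.+1%:R : R)%:E <= (n%:R)%:E.
  apply: le_trans le_n; apply: le_ereal_inf_tmp => _ [w Pw <-].
  rewrite lee_fin ler_nat ltnNge; apply/negP => le; apply: no.
  by exists w.
by rewrite lee_fin ler_nat ltnn.
Qed.

(** An infimum below [+oo] excludes the empty set, and a nonempty set of natural numbers has a least
    element. *)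
Lemma ereal_inf_natr_attained (T : Type) (f : T -> nat) (P : set T) :
  ereal_inf [set ((f w)%:R : R)%:E | w in P] < +oo ->
  exists2 w, P w & ((f w)%:R : R)%:E = ereal_inf [set ((f w)%:R : R)%:E | w in P].
Proof.
move=> fin.
have [[w0 Pw0]|/forallNP no] := pselect (exists w, P w); last first.
  move: fin; rewrite (_ : P = set0) ?image_set0 ?ereal_inf0 //.
  by apply/seteqP; split=> // w Pw; exact: (no w Pw).
have ex : exists n, `[< exists2 w, P w & f w = n >].
  by exists (f w0); apply/asboolP; exists w0.
case: (ex_minnP ex) => m /asboolP[w Pw <-] le_w; exists w => //.
apply/eqP; rewrite eq_le; apply/andP; split; last first.
  by apply: ereal_inf_lbound; exists w.
apply: le_ereal_inf_tmp => _ [w' Pw' <-]; rewrite lee_fin ler_nat.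
by apply: le_w; apply/asboolP; exists w'.
Qed.

Variables (A : finType) (G : machine R A).
Hypothesis hG : generator G.

Lemma card1_eq (T : finType) (s t : T) : #|T| == 1%N -> s = t.
Proof. by move=> /eqP c1; apply: (card_le1_eqP (A := T)); rewrite ?c1. Qed.

Lemma L_tar_ge0 : 0 <= L_tar G.
Proof.
by rewrite /L_tar; case: ifP => // _; apply: bigmax_ge_id.
Qed.

Lemma L_tar_words : L_tar G < +oo ->
  exists n : nat, (n%:R : R)%:E <= L_tar G /\
    forall s : state G, exists2 w, synchronizes w s & (size w <= n)%N.
Proof.
rewrite /L_tar; case: ifP => [c1 _|_ fin].
  (* A single state: the radius is 0 by convention, and the empty word does synchronize. *)
  exists 0%N; split=> // s; exists [::] => //; apply/(synchronizesP hG).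
  split=> [|t]; last by rewrite (card1_eq t s c1) eqxx.
  rewrite obs_probE (bigD1 s) //= obs_end_prob_nil.
  rewrite ltr_wpDr ?(stat_gt0 hG) // sumr_ge0 // => t _.
  exact: (obs_end_prob_ge0 hG).
pose F (s : state G) :=
  ereal_inf [set ((size w)%:R : R)%:E | w in [set w | synchronizes w s]].
(* [k s] is a shortest word synchronizing to [s]; the longest of these words provides the bound. *)
have /choice[k kP] (s : state G) :
    exists w, synchronizes w s /\ ((size w)%:R)%:E = F s.
  have [|w Pw e] := @ereal_inf_natr_attained _ size [set w | synchronizes w s].
    by apply: le_lt_trans fin; apply: (le_bigmax _ F).
  by exists w; split.
have [s0 _] : exists s : state G, true.
  by case/card_gt0P: (state_nonempty hG) => s0; exists s0.
case: (@arg_maxnP _ s0 xpredT (fun s => size (k s))) => // m _ max_m.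
exists (size (k m)); split; last by move=> s; exists (k s); [case: (kP s) | apply: max_m].
by rewrite (kP m).2; apply: (le_bigmax _ F).
Qed.

Lemma L_sep_words (n : nat) (s t : state G) : L_sep G <= (n%:R)%:E ->
  (forall v, (size v <= n)%N -> word_prob s v = word_prob t v) -> s = t.
Proof.
rewrite /L_sep; case: ifP => [c1 _ _|_ le_n same]; first exact: card1_eq.
apply/eqP; apply: contraT => ne.
move/bigmax_leP: le_n => [_ /(_ (s, t) ne)] /ereal_inf_le_natr[v /= diff le].
by case: diff; apply: same.
Qed.

End Radii.

(** * Matching the states of two machines *)

Section Isomorphism.
Variables (R : realType) (A : finType) (G G' : machine R A).
Hypotheses (hG : generator G) (hG' : generator G').

Lemma isomorphic_of_matching (E : state G -> state G' -> Prop) :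
  (forall s, exists t, E s t) -> (forall t, exists s, E s t) ->
  (forall s t t', E s t -> E s t' -> t = t') ->
  (forall s s' t, E s t -> E s' t -> s = s') ->
  (forall s t x, E s t -> emit s x = emit t x) ->
  (forall s t x s' t', E s t -> admissible s x -> delta s x = Some s' ->
     delta t x = Some t' -> E s' t') ->
  isomorphic G G'.
Proof.
move=> /choice[f fE] /choice[g gE] funE injE emitE stepE; exists f.
have bijf : bijective f.
  by exists g => [s|t]; [apply: (injE _ _ (f s)) | apply: (funE (g t))].
have deltaE s x : admissible s x -> delta (f s) x = omap f (delta s x).
  move=> ad; have adf : admissible (f s) x by rewrite /admissible -(emitE _ _ x (fE s)).
  case e: (delta s x) (delta_defined hG s x) => [s'|]; last by rewrite ad.
  case e': (delta (f s) x) (delta_defined hG' (f s) x) => [t'|]; last by rewrite adf.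
  by move=> _ _ /=; congr Some; apply: (funE s') => //; apply: stepE e e'.
split=> // [s|s x]; last by rewrite (emitE _ _ x (fE s)).
(* The law of [G'] pulled back along [f] is stationary for [G], since [f] carries transitions to
   transitions; uniqueness identifies it with [stat]. *)
apply: (stat_unique hG (q := fun s => stat (f s))).
have [[_ sum1] st] := stat_stationary hG'.
have onbij : {on xpredT, bijective f} by apply: onW_bij.
split; first by split=> [s'|]; [apply: stat_ge0 | rewrite -sum1 [RHS](reindex f)].
move=> t; rewrite -(st (f t)) [RHS](reindex f) //.
apply: eq_bigr => s' _; congr (_ * _); apply: eq_big => [x|x _].
  have -> : admissible (f s') x = admissible s' x by rewrite /admissible (emitE _ _ x (fE s')).
  case ad: (admissible s' x) => //=; rewrite deltaE //.
  by case: (delta s' x) => //= s2; rewrite !(inj_eq (@Some_inj _)) (bij_eq bijf).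
by rewrite (emitE _ _ x (fE s')).
Qed.

(** Table equality freed from the processes, so that the combinatorial argument involves the
    machines alone. *)
Definition tables_agree (L r : nat) : Prop :=
  forall u, (0 < size u <= L)%N ->
    (0 < obs_prob G u) = (0 < obs_prob G' u) /\
    (0 < obs_prob G u -> forall v, (size v <= r)%N ->
      obs_prob G (u ++ v) / obs_prob G u = obs_prob G' (u ++ v) / obs_prob G' u).

(** The two machines may coincide; in that form it also expresses the separation hypotheses. *)
Definition indistinguishable (n : nat) (s : state G) (t : state G') : Prop :=
  forall v, (size v <= n)%N -> word_prob s v = word_prob t v.

Lemma indistinguishable_emit n s t x : (0 < n)%N ->
  indistinguishable n s t -> emit s x = emit t x.
Proof. by move=> n0 /(_ [:: x] n0); rewrite (word_prob1 hG) (word_prob1 hG'). Qed.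

(** Cancelling the common positive emission of [x] in the word [x :: v] costs one letter of
    depth. *)
Lemma indistinguishable_step n s t x s' t' :
  indistinguishable n.+1 s t -> admissible s x ->
  delta s x = Some s' -> delta t x = Some t' -> indistinguishable n s' t'.
Proof.
move=> st ad e e' v lev; have emE := indistinguishable_emit x (ltn0Sn n) st.
have adt : admissible t x by rewrite /admissible -emE.
have /= := st (x :: v) lev; rewrite (word_prob_cons _ e) // (word_prob_cons _ e') //.
by rewrite emE => /(mulfI (lt0r_neq0 adt)).
Qed.

(** Given a synchronizing [u], the conditional probabilities are the word probabilities from the
    state reached, and the table equates them. *)
Lemma common_sync_indistinguishable L r u s t :
  tables_agree L r -> (0 < size u <= L)%N ->
  synchronizes u s -> synchronizes u t -> indistinguishable r s t.
Proof.
move=> agree leu su tu v lev; have [_ H] := agree u leu.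
have pos := ((synchronizesP hG u s).1 su).1.
have pos' := ((synchronizesP hG' u t).1 tu).1.
move: (H pos v lev); rewrite (obs_prob_sync_cat hG _ su) (obs_prob_sync_cat hG' _ tu).
by rewrite !(mulrC (obs_prob _ u)) !mulfK ?lt0r_neq0.
Qed.

(* In G', [w] can be emitted from some state [t0]; prefixing it with a word
   synchronizing G' to [t0] makes it synchronize both machines. The result is
   empty only if both have one state, and then any letter serves as [u]. *)
Lemma common_sync_word L r a b (s : state G) :
  tables_agree L r -> (a + b <= L)%N -> (0 < L)%N ->
  (exists2 w, synchronizes w s & (size w <= a)%N) ->
  (forall t : state G', exists2 w, synchronizes w t & (size w <= b)%N) ->
  exists u (t : state G'), [/\ synchronizes u s, synchronizes u t, (0 < size u <= L)%N &
    (size u <= a + b)%N \/ forall t1 t2 : state G', t1 = t2].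
Proof.
move=> agree leL L0 [w sw lew] sync'.
have nonempty_case u (t : state G') : synchronizes u s -> synchronizes u t ->
    (0 < size u <= a + b)%N -> exists u (t : state G'), [/\ synchronizes u s, synchronizes u t,
    (0 < size u <= L)%N &
    (size u <= a + b)%N \/ forall t1 t2 : state G', t1 = t2].
  move=> su tu /andP[u0 leu]; exists u, t; split=> //; last by left.
  by rewrite u0 (leq_trans leu leL).
have pos := ((synchronizesP hG w s).1 sw).1.
have [t0 w0] : exists t0 : state G', 0 < word_prob t0 w.
  (* The table does not index the empty word, which every state emits with probability 1; a nonempty
     [w] gets its positivity under [G'] from the table. *)
  case: (posnP (size w)) => [/size0nil -> |w0].
    by case/card_gt0P: (state_nonempty hG') => t0; exists t0; rewrite word_prob_nil.
  have lewL : (0 < size w <= L)%N.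
    by rewrite w0 (leq_trans lew) // (leq_trans _ leL) // leq_addr.
  by apply: (obs_prob_gt0 hG'); have [<- _] := agree w lewL.
have [w' sw' lew'] := sync' t0.
have [t tu] := sync_cat_right hG' sw' w0.
case: (posnP (size (w' ++ w))) => [|u0]; last first.
  have leu : (size (w' ++ w) <= a + b)%N by rewrite size_cat addnC leq_add.
  apply: (nonempty_case (w' ++ w) t) => //; last by rewrite u0.
  have leuL : (0 < size (w' ++ w) <= L)%N by rewrite u0 (leq_trans leu).
  (* Positivity of [w' ++ w] is known under [G']; the table carries it back to [G]. *)
  apply: (sync_cat_left hG) => //; have [-> _] := agree (w' ++ w) leuL.
  exact: ((synchronizesP hG' _ _).1 tu).1.
rewrite size_cat => /eqP; rewrite addn_eq0 !size_eq0 => /andP[/eqP w'0 /eqP wnil].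
rewrite {}w'0 {}wnil {w w'} in sw sw' tu w0 lew lew' pos *.
have one := sync_nil_unique hG sw; have one' := sync_nil_unique hG' sw'.
have [x x0] := exists_letter hG s.
have le1 : (0 < size [:: x] <= L)%N by [].
have sx : synchronizes [:: x] s.
  have pos1 : 0 < obs_prob G ([::] ++ [:: x]).
    by rewrite (obs_prob_sync_cat hG _ sw) (word_prob1 hG) mulr_gt0.
  apply/(synchronizesP hG); split=> // t1; by rewrite (one t1) eqxx.
have tx : synchronizes [:: x] t0.
  apply/(synchronizesP hG'); split=> [|t1]; last by rewrite (one' t1) eqxx.
  have [<- _] := agree [:: x] le1; exact: ((synchronizesP hG _ _).1 sx).1.
(* If [a = b = 0] this letter is longer than [a + b]; this is why the conclusion has its second
   alternative. *)
exists [:: x], t0; split=> //; right=> t1 t2; by rewrite (one' t1) (one' t2).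
Qed.

End Isomorphism.

Lemma tables_agree_sym (R : realType) (A : finType) (G G' : machine R A) L r :
  tables_agree G G' L r -> tables_agree G' G L r.
Proof.
move=> agree u leu; have [e H] := agree u leu; split=> // pos v lev.
by rewrite H ?e.
Qed.

(** The matching is indistinguishability up to length [r]. Here [d] is any depth that separates
    states, not necessarily the least one. *)
Lemma isomorphic_of_tables (R : realType) (A : finType) (G G' : machine R A)
    (hG : generator G) (hG' : generator G') (L r a b d : nat) :
  (0 < L)%N -> (0 < r)%N -> tables_agree G G' L r ->
  (forall s : state G, exists2 w, synchronizes w s & (size w <= a)%N) ->
  (forall t : state G', exists2 w, synchronizes w t & (size w <= b)%N) ->
  (forall s s' : state G, indistinguishable d s s' -> s = s') ->
  (forall t t' : state G', indistinguishable d t t' -> t = t') ->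
  ((a + b < L)%N /\ (d <= r)%N) \/ ((a + b <= L)%N /\ (d < r)%N) ->
  isomorphic G G'.
Proof.
move=> L0 r0 agree syncG syncG' sepG sepG' cases.
have [leL led] : (a + b <= L)%N /\ (d <= r)%N.
  by case: cases => -[h1 h2]; split=> //; apply: ltnW.
have common s := common_sync_word hG hG' agree leL L0 (syncG s) syncG'.
have total (s : state G) : exists t : state G', indistinguishable r s t.
  have [u [t [su tu leu _]]] := common s.
  by exists t; apply: (common_sync_indistinguishable hG hG' agree leu).
(* The second match may be shallower than [r]: in the second case only depth [r - 1] survives a
   transition. *)
have functional d' (s : state G) (t t' : state G') : (d <= d')%N -> (d' <= r)%N ->
    indistinguishable r s t -> indistinguishable d' s t' -> t = t'.
  move=> le1 le2 st st'; apply: sepG' => v lev.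
  by rewrite -st ?st' // (leq_trans lev) // (leq_trans le1).
apply: (isomorphic_of_matching hG hG' (E := @indistinguishable _ _ G G' r)) => //.
- move=> t; rewrite addnC in leL.
  have [u [s [tu su leu _]]] :=
    common_sync_word hG' hG (tables_agree_sym agree) leL L0 (syncG' t) syncG.
  by exists s; apply: (common_sync_indistinguishable hG hG' agree leu).
- by move=> s t t' st; apply: functional st.
- move=> s s' t st s't; apply: sepG => v lev.
  by rewrite st ?s't // (leq_trans lev).
- by move=> s t x; apply: indistinguishable_emit.
move=> s t x s' t' st ad e e'.
case: cases => -[h1 h2]; last first.
  (* [s'] has a partner [t''] at full depth [r], while the transition matches it with [t'] at depth
     [r - 1 >= d]; hence [t'' = t']. *)
  have [t'' s't''] := total s'; case: r r0 h2 st s't'' functional {agree led total common}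
    => // n _ h2 st s't'' functional.
  rewrite -(functional n s' t'' t') //.
  exact: (indistinguishable_step hG hG' st ad e e').
have [u [t1 [su t1u leu cs]]] := common s.
(* The state of [G'] to which [u] synchronizes is also a partner of [s], hence it is [t]. *)
have {t1 t1u} tu : synchronizes u t.
  have st1 := common_sync_indistinguishable hG hG' agree leu su t1u.
  by rewrite (functional r s t t1).
(* If [u] has length at most [a + b < L], the word [rcons u x] is still in the table and
   synchronizes to [s'] and [t']. Otherwise [G'] has one state, and any partner of [s'] is [t']. *)
case: cs => [le_ab|one].
  have adt : admissible t x.
    by rewrite /admissible -(indistinguishable_emit hG hG' x r0 st).
  apply: (common_sync_indistinguishable hG hG' (u := rcons u x) agree).
  - by rewrite size_rcons ltnS (leq_ltn_trans le_ab).
  - exact: (sync_rcons hG su ad e).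
  - exact: (sync_rcons hG' tu adt e').
by have [t'' s't''] := total s'; rewrite (one t' t'').
Qed.

(** * From laws of processes to word probabilities *)

Section Process.
Variables (R : realType) (A : finType).

Lemma block_cat (B T : Type) (X : int -> T -> B) i m n o :
  block X i (m + n) o = block X i m o ++ block X (i + m%:Z) n o.
Proof.
rewrite /block /mkseq iotaD map_cat add0n -[in iota m n](addn0 m) iotaDl -map_comp.
by congr (_ ++ _); apply: eq_map => k /=; rewrite PoszD addrA.
Qed.

Lemma block_cons (B T : Type) (X : int -> T -> B) i n o :
  block X i n.+1 o = X i o :: block X (i + 1) n o.
Proof. by rewrite -add1n block_cat /block /= addr0. Qed.

Lemma measurable_block (d : measure_display) (T : measurableType d) (B : Type)
    (X : int -> T -> B) i n (w : seq B) :
  (forall t x, measurable [set o | X t o = x]) ->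
  measurable [set o | block X i n o = w].
Proof.
move=> mX; elim: n i w => [|n IH] i [|x w].
- by rewrite (_ : [set _ | _] = setT) //; apply/seteqP; split.
- by rewrite (_ : [set _ | _] = set0) //; apply/seteqP; split.
- by rewrite (_ : [set _ | _] = set0) //; apply/seteqP; split.
rewrite (_ : [set _ | _] = [set o | X i o = x] `&` [set o | block X (i + 1) n o = w]).
  exact: measurableI.
by apply/seteqP; split=> o /=; rewrite block_cons => -[-> ->].
Qed.

Lemma measure_finite_partition (d : measure_display) (T : measurableType d)
    (mu : {measure set T -> \bar R}) (I : finType) (F : T -> I) (E : set T) :
  (forall i, measurable (E `&` [set o | F o = i])) ->
  mu E = (\sum_i mu (E `&` [set o | F o = i]))%E.
Proof.
move=> mE; rewrite fsbig_seq ?index_enum_uniq // -measure_fin_bigcup //.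
- congr (mu _); apply/seteqP; split=> o; last by case=> i _ [].
  by move=> Eo; exists (F o) => //=; rewrite mem_index_enum.
- by move=> i j _ _ [x [[_ <-] [_ <-]]].
Qed.

(** The event is partitioned by the hidden states, whose joint law with the block is prescribed by
    [generates]. The value does not depend on [i], which is stationarity. *)
Lemma law_block (G : machine R A) (P : process R A) i (w : seq A) :
  generates G P ->
  law P [set o | block (@obs _ _ P) i (size w) o = w] = (obs_prob G w)%:E.
Proof.
case=> S [mS lawE]; set E := [set o | _].
(* The hidden window starts at [i - 1], since [generates] places the initial state one step before
   the block. *)
pose F o := (S (i - 1) o, [tuple of block S i (size w) o]).
have slice s (p : (size w).-tuple (state G)) : E `&` [set o | F o = (s, p)] =
    [set o | [/\ S (i - 1) o = s, block (@obs _ _ P) (i - 1 + 1) (size w) o = in_tuple w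
                & block S (i - 1 + 1) (size w) o = p]].
  rewrite subrK; apply/seteqP; split=> o /=.
    by case=> Eo [<- <-].
  by case=> <- Eo ep; split=> //; congr pair; apply: val_inj.
rewrite (measure_finite_partition (law P) (F := F)) => [|[s p]]; last first.
  rewrite slice (_ : [set o | _] = [set o | S (i - 1) o = s] `&`
      [set o | block (@obs _ _ P) (i - 1 + 1) (size w) o = w] `&`
      [set o | block S (i - 1 + 1) (size w) o = p]).
    apply: measurableI; first apply: measurableI => //.
      by apply: measurable_block => t x; apply: obs_measurable.
    exact: measurable_block.
  by apply/seteqP; split=> o; [case | case=> -[]].
transitivity (\sum_(s : state G) \sum_(p : (size w).-tuple (state G))
    (stat s * path_prob s w p)%:E)%E.
  rewrite pair_bigA /=; apply: eq_bigr => -[s p] _.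
  by rewrite slice (lawE _ _ _ (in_tuple w)).
under eq_bigr => s _ do rewrite sumEFin -big_distrr.
by rewrite sumEFin.
Qed.

Lemma law_past (G : machine R A) (P : process R A) u : generates G P ->
  law P (past u) = (obs_prob G u)%:E.
Proof. exact: law_block. Qed.

(** The past block ends at time 0 and the future block starts at time 1, so together they form one
    block reading [u ++ v]. *)
Lemma law_future_past (G : machine R A) (P : process R A) u v : generates G P ->
  law P (future v `&` past u) = (obs_prob G (u ++ v))%:E.
Proof.
move=> gen; rewrite -(law_block (1 - (size u)%:Z) _ gen); congr (law P _).
rewrite /future /past size_cat; apply/seteqP.
split=> o /=; rewrite block_cat subrK; first by case=> -> ->.
by move/eqP; rewrite eqseq_cat ?size_mkseq // => /andP[/eqP -> /eqP ->].
Qed.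

Lemma tables_agree_of_same_table (G G' : machine R A) (P Q : process R A) L r :
  generates G P -> generates G' Q -> same_table L r P Q -> tables_agree G G' L r.
Proof.
move=> genP genQ [ctx cond] u leu.
have ctxP : contexts P L u <-> 0 < obs_prob G u.
  by rewrite /contexts /= (law_past u genP) lte_fin; split=> [[]|].
have ctxQ : contexts Q L u <-> 0 < obs_prob G' u.
  by rewrite /contexts /= (law_past u genQ) lte_fin; split=> [[]|].
split.
  by apply/idP/idP => [/ctxP|/ctxQ]; [rewrite ctx => /ctxQ | rewrite -ctx => /ctxP].
move=> /ctxP cu v lev; have := cond u v cu lev.
by rewrite /cond_prob !(law_future_past _ _ genP, law_past _ genP,
  law_future_past _ _ genQ, law_past _ genQ).
Qed.

End Process.

(** * Passage from extended-real radii to natural numbers *)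

Theorem theorem5p2 (R : realType) (A : finType) (hA : (0 < #|A|)%N)
    (GP GQ : machine R A) (hGP : generator GP) (hGQ : generator GQ)
    (exactP : exact_machine GP) (exactQ : exact_machine GQ)
    (P Q : process R A) (hP : generates GP P) (hQ : generates GQ Q)
    (L r : nat) (hL : (1 <= L)%N) (hr : (1 <= r)%N)
    (hC : same_table L r P Q) :
  let a := L_tar GP in
  let b := L_tar GQ in
  let d := maxe (L_sep GP) (L_sep GQ) in
  ((a + b + 1 <= (L%:R)%:E)%E /\ (maxe 1 d <= (r%:R)%:E)%E) \/
  ((a + b <= (L%:R)%:E)%E /\ (d + 1 <= (r%:R)%:E)%E) ->
  isomorphic GP GQ.
Proof.
move=> a b d radii.
(* Both conditions give this bound, which makes both target radii finite. *)
have leL : (a + b <= (L%:R)%:E)%E.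
  case: radii => -[le _] //; apply: le_trans le.
  by rewrite leeDl // lee01.
have fin x : (x <= a + b)%E -> (x < +oo)%E.
  by move=> le; apply: (le_lt_trans (le_trans le leL)); rewrite ltry.
have [a' [lea syncP]] : exists n : nat, ((n%:R)%:E <= a)%E /\
    forall s : state GP, exists2 w, synchronizes w s & (size w <= n)%N.
  by apply: (L_tar_words hGP); apply: fin; rewrite leeDl // L_tar_ge0.
have [b' [leb syncQ]] : exists n : nat, ((n%:R)%:E <= b)%E /\
    forall s : state GQ, exists2 w, synchronizes w s & (size w <= n)%N.
  by apply: (L_tar_words hGQ); apply: fin; rewrite leeDr // L_tar_ge0.
have leab : (((a' + b')%:R)%:E <= a + b)%E by rewrite natrD EFinD leeD.
(* Separation is applied with [d'] equal to [r] under the first condition and to [r - 1] under the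
   second, so [d] itself need not be turned into a natural number. *)
have sep d' : (d <= (d'%:R)%:E)%E ->
    (forall s s' : state GP, indistinguishable d' s s' -> s = s') /\
    (forall t t' : state GQ, indistinguishable d' t t' -> t = t').
  by rewrite ge_max => /andP[dP dQ]; split=> s s'; apply: L_sep_words.
have agree := tables_agree_of_same_table hP hQ hC.
case: radii => -[le1 le2].
  move: le2; rewrite ge_max => /andP[_ /sep[sepP sepQ]].
  apply: (isomorphic_of_tables hGP hGQ hL hr agree syncP syncQ sepP sepQ).
  left; split=> //; have := le_trans (leeD leab (lexx 1%E)) le1.
  by rewrite -EFinD lee_fin natr1 ler_nat.
(* From here [r] denotes the former bound minus one, and cancelling 1 yields [d <= r]. *)
case: r hr le2 {hC} agree => // r _ le2 agree.
have /sep[sepP sepQ] : (d <= (r%:R)%:E)%E.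
  by move: le2; rewrite -natr1 EFinD leeD2rE.
apply: (isomorphic_of_tables hGP hGQ hL _ agree syncP syncQ sepP sepQ) => //.
by right; split=> //; have := le_trans leab leL; rewrite lee_fin ler_nat.
Qed.
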